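(* For every $n\ge 1$, the mapping $\widehat{\phi}=\Phi_{\mathrm{SZ}}^{-1}\circ\widehat{\theta}\circ\Phi_{\mathrm{SZ}}$ is an involution on $\mathfrak{S}_n$ such that for all $\sigma\in\mathfrak{S}_n$, $$\big(\underline{31}2(\sigma),\,2\underline{31}(\sigma)\big)=\big(\underline{31}2(\widehat{\phi}(\sigma)),\,2\underline{13}(\widehat{\phi}(\sigma))\big).$$
   Context: $\mathfrak{S}_n$ is the set of permutations $\sigma=\sigma_1\cdots\sigma_n$ of $[n]=\{1,\dots,n\}$; $\sigma^{-1}_\ell$ denotes the position of the letter $\ell$ in $\sigma$. Vincular pattern statistics: for $1\le \ell\le n$ let - $2\underline{13}(\ell,\sigma)=\#\{j:\sigma^{-1}_\ell<j<n,\ \sigma_j<\ell<\sigma_{j+1}\}$, - $2\underline{31}(\ell,\sigma)=\#\{j:\sigma^{-1}_\ell<j<n,\ \sigma_{j+1}<\ell<\sigma_j\}$, - $\underline{31}2(\ell,\sigma)=\#\{j:1<j<\sigma^{-1}_\ell,\ \sigma_j<\ell<\sigma_{j-1}\}$, and let $2\underline{13}(\sigma)$, $2\underline{31}(\sigma)$, $\underline{31}2(\sigma)$ be the sums of the corresponding quantities over $1\le\ell\le n$. The bijection $\Phi_{\mathrm{SZ}}:\mathfrak{S}_n\to\mathfrak{S}_n$: given $\sigma$, let $F$ be the set of descent tops (letters $\sigma_i$ with $1\le i<n$, $\sigma_i>\sigma_{i+1}$) and $F'$ the set of descent bottoms (letters $\sigma_{i+1}$ with $1\le i<n$, $\sigma_i>\sigma_{i+1}$);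 let $G=[n]\setminus F$, $G'=[n]\setminus F'$. Define $\tau=\Phi_{\mathrm{SZ}}(\sigma)$ as follows. Going through $j\in F$ from the smallest to the largest, let $\tau_j$ be the $(\underline{31}2(j,\sigma)+1)$-th largest entry of $F'$ that is smaller than $j$ and not yet chosen. Going through $j\in G$ from the largest to the smallest, let $\tau_j$ be the $(\underline{31}2(j,\sigma)+1)$-th smallest entry of $G'$ that is not smaller than $j$ and not yet chosen. (This is known to be a well-defined bijection.) The map $\widehat{\theta}:\mathfrak{S}_n\to\mathfrak{S}_n$ is $\widehat{\theta}(\sigma)=\widehat{\sigma}_n\widehat{\sigma}_{n-1}\cdots\widehat{\sigma}_1$, where $\widehat{a}=n-a$ if $1\le a<n$ and $\widehat{n}=n$. *)

(* Defs.v *)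
From mathcomp Require Import all_boot all_fingroup.
From mathcomp Require Import zify.

Set Implicit Arguments.
Unset Strict Implicit.
Unset Printing Implicit Defensive.

(* A permutation sigma : 'S_n is read as the word sigma_1 ... sigma_n; both
   positions and letters are shifted down by one, so that the ordinal i stands
   for i.+1 in [n], sigma i is the letter at position i, and sigma^-1 l is the
   position of the letter l. *)

(* A pair p with succ_pos p stands for two adjacent positions (j, j + 1). *)
Definition succ_pos n (p : 'I_n * 'I_n) : bool := p.2 == p.1.+1 :> nat.

Definition stat213_at n (l : 'I_n) (sigma : 'S_n) : nat :=
  #|[set p : 'I_n * 'I_n | [&& succ_pos p, (sigma^-1)%g l < p.1,
                               sigma p.1 < l & l < sigma p.2]]|.

Definition stat231_at n (l : 'I_n) (sigma : 'S_n) : nat :=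
  #|[set p : 'I_n * 'I_n | [&& succ_pos p, (sigma^-1)%g l < p.1,
                               sigma p.2 < l & l < sigma p.1]]|.

Definition stat312_at n (l : 'I_n) (sigma : 'S_n) : nat :=
  #|[set p : 'I_n * 'I_n | [&& succ_pos p, p.2 < (sigma^-1)%g l,
                               sigma p.2 < l & l < sigma p.1]]|.

Definition stat213 n (sigma : 'S_n) : nat := \sum_(l < n) stat213_at l sigma.
Definition stat231 n (sigma : 'S_n) : nat := \sum_(l < n) stat231_at l sigma.
Definition stat312 n (sigma : 'S_n) : nat := \sum_(l < n) stat312_at l sigma.

Definition descents n (sigma : 'S_n) : {set 'I_n * 'I_n} :=
  [set p | succ_pos p & sigma p.2 < sigma p.1].
Definition descent_tops n (sigma : 'S_n) : {set 'I_n} :=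
  [set sigma p.1 | p in descents sigma].
Definition descent_bottoms n (sigma : 'S_n) : {set 'I_n} :=
  [set sigma p.2 | p in descents sigma].

(* The letters in the order in which the algorithm visits them: enum of a set
   of ordinals is increasing. *)
Definition SZ_order n (sigma : 'S_n) : seq 'I_n :=
  enum (descent_tops sigma) ++ rev (enum (~: descent_tops sigma)).

(* Candidates for tau_j, listed so that the k-th largest (j in F), resp. the
   k-th smallest (j in G), comes k-th. *)
Definition SZ_candidates n (sigma : 'S_n) (j : 'I_n) : seq 'I_n :=
  if j \in descent_tops sigma
  then rev [seq x : 'I_n <- enum (descent_bottoms sigma) | x < j]
  else [seq x : 'I_n <- enum (~: descent_bottoms sigma) | j <= x].

(* The default value of nth is never used, see size_SZ_available. *)
Fixpoint SZ_choose n (sigma : 'S_n) (chosen js : seq 'I_n) : seq 'I_n :=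
  if js is j :: js' then
    let available := [seq x <- SZ_candidates sigma j | x \notin chosen] in
    let x := nth j available (stat312_at j sigma) in
    x :: SZ_choose sigma (x :: chosen) js'
  else [::].

Definition SZ_fun n (sigma : 'S_n) (j : 'I_n) : 'I_n :=
  nth j (SZ_choose sigma [::] (SZ_order sigma)) (index j (SZ_order sigma)).

Section WellDefined.
Variables (n : nat) (sigma : 'S_n).
Implicit Types (j x : 'I_n) (p : 'I_n * 'I_n).

Local Notation F := (descent_tops sigma).
Local Notation F' := (descent_bottoms sigma).
Local Notation D := (descents sigma).

Lemma succ_pos_inj1 : {in D &, injective (fun p => sigma p.1)}.
Proof.
move=> [a b] [c d]; rewrite !inE /succ_pos /= => /andP[/eqP h1 _] /andP[/eqP h2 _].
move=> /perm_inj h; subst c; congr pair; by apply: val_inj; rewrite /= h1 h2.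
Qed.

Lemma succ_pos_inj2 : {in D &, injective (fun p => sigma p.2)}.
Proof.
move=> [a b] [c d]; rewrite !inE /succ_pos /= => /andP[/eqP h1 _] /andP[/eqP h2 _].
move=> /perm_inj h; subst d; congr pair; apply: val_inj; rewrite /= in h1 h2 *; lia.
Qed.

Lemma card_tops (P : pred 'I_n) :
  #|[set x in F | P x]| = #|[set p in D | P (sigma p.1)]|.
Proof.
rewrite -(@card_in_imset _ _ (fun p => sigma p.1)); last first.
  by move=> p q; rewrite !inE => /andP[hp _] /andP[hq _];
     apply: succ_pos_inj1; rewrite inE.
apply: eq_card => x; rewrite !inE; apply/andP/imsetP.
  by case=> /imsetP[p hp ->] hx; exists p => //; rewrite inE hp.
by case=> p; rewrite inE => /andP[hp hx] ->; split=> //; apply: imset_f.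
Qed.

Lemma card_bottoms (P : pred 'I_n) :
  #|[set x in F' | P x]| = #|[set p in D | P (sigma p.2)]|.
Proof.
rewrite -(@card_in_imset _ _ (fun p => sigma p.2)); last first.
  by move=> p q; rewrite !inE => /andP[hp _] /andP[hq _];
     apply: succ_pos_inj2; rewrite inE.
apply: eq_card => x; rewrite !inE; apply/andP/imsetP.
  by case=> /imsetP[p hp ->] hx; exists p => //; rewrite inE hp.
by case=> p; rewrite inE => /andP[hp hx] ->; split=> //; apply: imset_f.
Qed.

Lemma card_candidates_top j : j \in F ->
  #|[set x in F | x < j]| + stat312_at j sigma < #|[set x in F' | x < j]|.
Proof.
move=> /imsetP[p0 hp0 hj].
rewrite (card_tops (fun x => x < j)) (card_bottoms (fun x => x < j)).
pose A := [set p in D | sigma p.1 < j].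
pose B := [set p | [&& succ_pos p, p.2 < (sigma^-1)%g j, sigma p.2 < j & j < sigma p.1]].
rewrite -/A -[stat312_at _ _]/#|B|.
have AB : A :&: B = set0.
  by apply/setP=> p; rewrite !inE; apply/negP=> /andP[/andP[_ h1] /and4P[_ _ _ h2]]; lia.
rewrite -[leqLHS]/(_.+1) -cardsUI AB cards0 addn0.
apply: proper_card; apply/properP; split.
  apply/subsetP=> p; rewrite !inE.
  case/orP=> [/andP[/andP[-> /= h1] h2] | /and4P[-> _ h1 h2]]; lia.
exists p0; move: hp0; rewrite !inE hj => /andP[-> /= h]; first by rewrite h.
by apply/negP=> /orP[/andP[_ h1] | /and3P[_ _ h1]]; lia.
Qed.

Lemma card_candidates_nontop j : j \notin F ->
  #|[set x in ~: F | j < x]| + stat312_at j sigma < #|[set x in ~: F' | j <= x]|.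
Proof.
move=> hj.
have h1 : #|[set x in F' | j <= x]| + stat312_at j sigma <= #|[set x in F | j < x]|.
  rewrite (card_tops (fun x => j < x)) (card_bottoms (fun x => j <= x)).
  pose A := [set p in D | j <= sigma p.2].
  pose B := [set p | [&& succ_pos p, p.2 < (sigma^-1)%g j, sigma p.2 < j & j < sigma p.1]].
  rewrite -/A -[stat312_at _ _]/#|B|.
  have AB : A :&: B = set0.
    by apply/setP=> p; rewrite !inE; apply/negP=> /andP[/andP[_ h1] /and4P[_ _ h2 _]]; lia.
  rewrite -cardsUI AB cards0 addn0; apply: subset_leq_card.
  apply/subsetP=> p; rewrite !inE.
  case/orP=> [/andP[/andP[-> /= h1] h2] | /and4P[-> _ h1 h2]]; lia.
have split_card (A : {set 'I_n}) (P : pred 'I_n) :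
    #|[set x in A | P x]| + #|[set x in ~: A | P x]| = #|[set x | P x]|.
  rewrite -[RHS](cardsID A); congr (_ + _); apply: eq_card => x;
  by rewrite !inE // andbC.
have h2 := split_card F (fun x => j < x).
have h3 := split_card F' (fun x => j <= x).
have h4 : #|[set x : 'I_n | j <= x]| = #|[set x : 'I_n | j < x]|.+1.
  rewrite (cardsD1 j) inE leqnn add1n; congr _.+1; apply: eq_card => x.
  by rewrite !inE ltn_neqAle eq_sym.
rewrite -(ltn_add2l #|[set x in F | j < x]|) addnA h2 -addSn -h4 -h3.
by rewrite addnAC leq_add2r.
Qed.

Lemma perm_SZ_order : perm_eq (SZ_order sigma) (enum 'I_n).
Proof.
apply: uniq_perm; rewrite ?enum_uniq // /SZ_order.
  rewrite cat_uniq rev_uniq !enum_uniq andbT /=; apply/hasPn=> x.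
  by rewrite mem_rev !mem_enum inE.
by move=> x; rewrite mem_cat mem_rev !mem_enum !inE orbN.
Qed.

Definition SZ_before x j :=
  ((x \in F) && (j \in F) ==> (x < j)) && ((x \notin F) && (j \notin F) ==> (j < x)).

Lemma pairwise_SZ_order : pairwise SZ_before (SZ_order sigma).
Proof.
have enumP (A : {set 'I_n}) : pairwise (fun x y => x < y) (enum A).
  have : pairwise (fun x y : 'I_n => x < y) (enum 'I_n).
    rewrite -(pairwise_map val ltn) val_enum_ord -sorted_pairwise ?iota_ltn_sorted //.
    exact: ltn_trans.
  rewrite [enum A]/enum_mem -enumT; exact: (subseq_pairwise (filter_subseq _ _)).
rewrite /SZ_order pairwise_cat; apply/and3P; split.
- apply/allrelP=> x y; rewrite mem_rev !mem_enum inE /SZ_before => -> hy.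
  by rewrite (negbTE hy).
- apply: (@sub_in_pairwise _ (mem F) _ _ _ _ _ (enumP F)).
    by move=> x y; rewrite /SZ_before => /= -> -> /= ->.
  by apply/allP=> x; rewrite mem_enum.
have revP : pairwise (fun x y => y < x) (rev (enum (~: F))).
  rewrite -sorted_pairwise; last by move=> x y z h1 h2; apply: ltn_trans h2 h1.
  by rewrite rev_sorted sorted_pairwise ?enumP // => x y z; apply: ltn_trans.
apply: (@sub_in_pairwise _ (mem (~: F)) _ _ _ _ _ revP).
  by move=> x y /=; rewrite !inE /SZ_before => /negbTE -> /negbTE -> /= ->.
by apply/allP=> x; rewrite mem_rev mem_enum.
Qed.

Lemma SZ_candidates_class j x :
  x \in SZ_candidates sigma j -> (x \in F') = (j \in F).
Proof.
rewrite /SZ_candidates; case: ifP => _.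
  by rewrite mem_rev mem_filter mem_enum => /andP[_ ->].
by rewrite mem_filter mem_enum inE => /andP[_ /negbTE].
Qed.

Lemma uniq_SZ_candidates j : uniq (SZ_candidates sigma j).
Proof.
by rewrite /SZ_candidates; case: ifP; rewrite ?rev_uniq filter_uniq ?enum_uniq.
Qed.

Lemma size_SZ_candidates j :
  size (SZ_candidates sigma j) =
    if j \in F then #|[set x in F' | x < j]| else #|[set x in ~: F' | j <= x]|.
Proof.
rewrite -(card_uniqP (uniq_SZ_candidates j)) /SZ_candidates.
by case: ifP => _; apply: eq_card => x;
   rewrite ?mem_rev mem_filter mem_enum !inE andbC.
Qed.

(* chosen consists of distinct letters, at most as many of each kind as there
   are visited letters of the corresponding kind. *)
Definition SZ_valid (visited chosen : seq 'I_n) :=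
  uniq chosen /\ forall b : bool,
    count (fun x => (x \in F') == b) chosen <= count (fun x => (x \in F) == b) visited.

Lemma size_SZ_available visited chosen j js :
    SZ_order sigma = visited ++ j :: js -> SZ_valid visited chosen ->
  stat312_at j sigma < size [seq x <- SZ_candidates sigma j | x \notin chosen].
Proof.
move=> e [uc hc]; have := hc (j \in F).
set a := count _ chosen; set b := count _ visited => ab.
have : uniq (SZ_order sigma) by rewrite (perm_uniq perm_SZ_order) enum_uniq.
have := pairwise_SZ_order; rewrite e pairwise_cat cat_uniq allrel_consr.
move=> /and3P[/andP[/allP hb _] _ _] /and3P[uv _ _].
have h1 : size (SZ_candidates sigma j) <=
    size [seq x <- SZ_candidates sigma j | x \notin chosen] + a.
  rewrite -(count_predC (mem chosen) (SZ_candidates sigma j)) addnC size_filter.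
  rewrite leq_add2l /a -!size_filter; apply: uniq_leq_size.
    exact: filter_uniq (uniq_SZ_candidates j).
  move=> x; rewrite !mem_filter /= => /andP[-> /SZ_candidates_class ->].
  by rewrite eqxx.
have h2 : b <= if j \in F then #|[set x in F | x < j]| else #|[set x in ~: F | j < x]|.
  rewrite /b -size_filter -(card_uniqP (filter_uniq _ uv)).
  case: ifP => hj; apply: subset_leq_card; apply/subsetP=> x;
  rewrite mem_filter !inE => /andP[/eqP hx /hb]; rewrite /SZ_before hx hj //=.
  by rewrite !andbT.
have h3 := size_SZ_candidates j.
case: (boolP (j \in F)) => hj; rewrite ?hj ?(negbTE hj) in h2 h3.
  by have := card_candidates_top hj; lia.
by have := card_candidates_nontop hj; lia.
Qed.

Lemma size_SZ_choose chosen js : size (SZ_choose sigma chosen js) = size js.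
Proof. by elim: js chosen => //= j js IH chosen; rewrite IH. Qed.

Lemma uniq_SZ_choose visited chosen js :
    SZ_order sigma = visited ++ js -> SZ_valid visited chosen ->
  uniq (rev chosen ++ SZ_choose sigma chosen js).
Proof.
elim: js visited chosen => [|j js IH] visited chosen e v.
  by rewrite cats0 rev_uniq; case: v.
have := mem_nth j (size_SZ_available e v); rewrite /=.
set x := nth _ _ _; rewrite mem_filter => /andP[xnew xcand].
rewrite -cat_rcons -rev_cons; apply: (IH (rcons visited j)); first by rewrite cat_rcons.
case: v => uc hc; split=> [|b]; first by rewrite /= xnew.
rewrite -cats1 count_cat /= (SZ_candidates_class xcand) addn0 addnC leq_add2r.
exact: hc.
Qed.

Lemma SZ_fun_inj : injective (SZ_fun sigma).
Proof.
have u : uniq (SZ_choose sigma [::] (SZ_order sigma)).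
  exact: (@uniq_SZ_choose [::] [::] _ erefl).
have hi j : index j (SZ_order sigma) < size (SZ_choose sigma [::] (SZ_order sigma)).
  by rewrite size_SZ_choose index_mem (perm_mem perm_SZ_order) mem_enum.
move=> i j; rewrite /SZ_fun (set_nth_default j _ (hi i)) => /eqP.
rewrite nth_uniq // => /eqP; apply: (index_inj i);
by rewrite (perm_mem perm_SZ_order) mem_enum.
Qed.

End WellDefined.

Definition PhiSZ n (sigma : 'S_n) : 'S_n := perm (@SZ_fun_inj n sigma).

(* The letter a stands for a.+1, so its image n - a.+1 is stored as
   (n - a.+1).-1. *)
Lemma hat_subproof n (a : 'I_n) : (if a.+1 < n then (n - a.+1).-1 else a) < n.
Proof. by case: a => a /=; case: ifP; lia. Qed.

Definition hat n (a : 'I_n) : 'I_n := Ordinal (hat_subproof a).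

Lemma thetahat_inj n (sigma : 'S_n) :
  injective (fun i : 'I_n => hat (sigma (rev_ord i))).
Proof.
have hat_inj : injective (@hat n).
  move=> [a ha] [b hb] /(congr1 val) /= h; apply: val_inj => /=.
  by move: h; do 2!case: ifP; lia.
by move=> i j /hat_inj /perm_inj /rev_ord_inj.
Qed.

Definition thetahat n (sigma : 'S_n) : 'S_n := perm (@thetahat_inj n sigma).

(* finv PhiSZ is the inverse of PhiSZ as soon as PhiSZ is injective, which is
   itself a consequence of phihat being an involution. *)
Definition phihat n : 'S_n -> 'S_n :=
  finv (@PhiSZ n) \o @thetahat n \o @PhiSZ n.

(* Main.v *)
Require Import Defs.
From mathcomp Require Import all_boot all_fingroup.
From mathcomp Require Import zify.

(** Write tau for [PhiSZ sigma].  The greedy choices defining tau make each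
    statistic of sigma readable from tau:
    - the descent tops of sigma are the j with tau j < j, and tau maps them onto
      the descent bottoms ([descent_topE], [PhiSZ_bottom]);
    - when j picks the candidate of rank [stat312_at j sigma], the candidates it
      skips are picked later, by the i that cross the arc j -> tau j; hence
      [stat312_at j sigma] is a number of crossings ([stat312_crossing]);
    - each descent straddling the letter l has l on one side, so
      [stat312_at] + [stat231_at] at l counts them all, and this is the number of
      arcs tau i < l < i ([stat312_231]);
    - along a word the steps up through the level l alternate with the steps down
      through it, so [stat213_at] and [stat231_at] at l differ only by boundary
      terms, in which the last letter of sigma appears ([stat213_231]); that
      letter is the preimage of the maximum under tau ([PhiSZ_last]).

    The map [thetahat] reverses positions and, apart from the maximum, values.  It
    exchanges the arcs below the diagonal with those on or above it; the exception
    made for the maximum is balanced by the fact that, for any cut l, as many arcs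
    of a permutation go down across l as go up across it
    ([arcs_across_balance]).  So crossings at j become crossings at
    [rev_ord j] ([crossing_thetahat]), and the arcs straddling l become those
    straddling [rev_ord l], up to exactly the boundary terms above
    ([straddle_thetahat]).  This yields a letter by letter refinement of the
    identity of the theorem ([stats_thetahat]).

    To speak of the inverse of [PhiSZ], it must be injective: by the first two
    points tau determines the descent tops, the descent bottoms and the numbers
    [stat312_at j sigma], and these determine sigma.  The word is rebuilt by
    inserting the letters from the largest down: the number of descents that
    straddle a letter from its left, and whether it is a descent bottom, say where
    it goes ([reconstruction]).  As [thetahat] is an involution, so is its
    conjugate by [PhiSZ]. *)

Set Implicit Arguments.
Unset Strict Implicit.
Unset Printing Implicit Defensive.

(** * Reading the statistics from the image under PhiSZ *)

(** Recovers the rank used by a call to [nth] from the element it returned. *)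
Lemma count_pairwise_nth (T : eqType) (r : rel T) x0 s i :
    (forall x y, r x y -> ~~ r y x) -> pairwise r s -> i < size s ->
  count (r^~ (nth x0 s i)) s = i.
Proof.
move=> asym; elim: s i => [|x s IH] [|i] //= /andP[/allP rx rs].
  move=> _; rewrite (_ : r x x = false); last by apply/negP=> h; have := asym _ _ h; rewrite h.
  rewrite add0n; apply/eqP; rewrite -leqn0 leqNgt -has_count; apply/hasPn=> y ys.
  exact: asym (rx y ys).
by rewrite ltnS => hi; rewrite rx ?mem_nth // IH.
Qed.

(** The arcs i -> t i and j -> t j cross, both below the diagonal (first disjunct)
    or both above it (second disjunct).  The pair is attributed to the arc
    whose source is visited first in [SZ_order], so that the crossings at j count
    the candidates skipped when the image of j is chosen. *)
Definition crossing n (t : 'S_n) (i j : 'I_n) : bool :=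
  (j < i) && (t j < t i < j) || (i < j) && (j <= t i < t j).

Section Phi.
Variables (n : nat) (sigma : 'S_n).
Implicit Types (i j l x y : 'I_n) (v js : seq 'I_n).

Local Notation F := (descent_tops sigma).
Local Notation F' := (descent_bottoms sigma).
Local Notation tau := (PhiSZ sigma).
Local Notation order := (SZ_order sigma).

Lemma SZ_choose_rcons chosen v j :
  let c := SZ_choose sigma chosen v in
  SZ_choose sigma chosen (rcons v j) =
    rcons c (nth j [seq x <- SZ_candidates sigma j | x \notin rev c ++ chosen]
                 (stat312_at j sigma)).
Proof.
elim: v chosen => [|i v IH] chosen //=.
by rewrite IH /= rev_cons cat_rcons.
Qed.

(** The invariant [SZ_valid] that guarantees enough candidates holds at every stage
    of the algorithm, so no choice ever falls back on a default value. *)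
Lemma SZ_choose_valid v js :
  order = v ++ js -> SZ_valid sigma v (rev (SZ_choose sigma [::] v)).
Proof.
elim/last_ind: v js => [|v j IH] js // e.
have e' : order = v ++ j :: js by rewrite e cat_rcons.
have V := IH _ e'; rewrite SZ_choose_rcons rev_rcons cats0.
have := mem_nth j (size_SZ_available e' V).
set x := nth _ _ _; rewrite mem_filter => /andP[xnew xcand].
case: V => uc hc; split=> [|b]; first by rewrite /= xnew.
rewrite -cats1 count_cat /= (SZ_candidates_class xcand) addn0 addnC leq_add2r.
exact: hc.
Qed.

Lemma SZ_choose_order : SZ_choose sigma [::] order = map tau order.
Proof.
have uo : uniq order by rewrite (perm_uniq (perm_SZ_order sigma)) enum_uniq.
case E: order => [|j0 o] //; rewrite -E.
apply: (@eq_from_nth _ j0); rewrite size_SZ_choose ?size_map // => k hk.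
rewrite (nth_map j0) // permE /SZ_fun index_uniq //.
by apply: set_nth_default; rewrite size_SZ_choose.
Qed.

Lemma SZ_choose_prefix v js :
  order = v ++ js -> SZ_choose sigma [::] v = map tau v.
Proof.
move=> e; have := SZ_choose_order; rewrite e.
have catE chosen u w : exists r,
    SZ_choose sigma chosen (u ++ w) = SZ_choose sigma chosen u ++ r.
  elim: u chosen => [|i u IH] chosen /=; first by eexists.
  by have [r ->] := IH (nth i [seq x <- SZ_candidates sigma i | x \notin chosen]
    (stat312_at i sigma) :: chosen); exists r.
have [r ->] := catE [::] v js; rewrite map_cat => /eqP.
by rewrite eqseq_cat ?size_SZ_choose ?size_map // => /andP[/eqP].
Qed.

(** The greedy step as an equation on tau itself: the letters already chosen are
    the images of the letters already visited. *)
Lemma PhiSZ_nth v j js (avail := [seq x <- SZ_candidates sigma j | x \notin map tau v]) :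
    order = v ++ j :: js ->
  stat312_at j sigma < size avail /\ tau j = nth j avail (stat312_at j sigma).
Proof.
move=> e; have := size_SZ_available e (SZ_choose_valid e).
have := @SZ_choose_prefix (rcons v j) js; rewrite cat_rcons SZ_choose_rcons.
move/(_ e); rewrite cats0 (SZ_choose_prefix e).
have -> : [seq x <- SZ_candidates sigma j | x \notin rev (map tau v)] = avail.
  by apply: eq_filter => x; rewrite mem_rev.
by rewrite map_rcons => /rcons_inj[<-].
Qed.

Lemma SZ_order_split j : exists v js, order = v ++ j :: js.
Proof.
have: j \in order by rewrite (perm_mem (perm_SZ_order sigma)) mem_enum.
by case/splitPr=> v js; exists v, js.
Qed.

Lemma PhiSZ_candidate j : tau j \in SZ_candidates sigma j.
Proof.
have [v [js e]] := SZ_order_split j; have [hs ht] := PhiSZ_nth e.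
by have := mem_nth j hs; rewrite -ht mem_filter => /andP[].
Qed.

Lemma mem_SZ_candidates j x :
  x \in SZ_candidates sigma j
    = ((x \in F') == (j \in F)) && (if j \in F then x < j else j <= x).
Proof.
rewrite /SZ_candidates; case: ifP => _; rewrite ?mem_rev mem_filter mem_enum andbC ?inE //.
  by rewrite eqb_id.
by rewrite eqbF_neg.
Qed.

Lemma descent_topE j : (j \in F) = (tau j < j).
Proof.
have := PhiSZ_candidate j; rewrite mem_SZ_candidates => /andP[_].
by case: ifP => _ h; rewrite ?h // ltnNge h.
Qed.

Lemma PhiSZ_bottom j : (tau j \in F') = (j \in F).
Proof. exact/SZ_candidates_class/PhiSZ_candidate. Qed.

Lemma pairwise_SZ_candidates j :
  pairwise (fun x y => if j \in F then y < x else x < y) (SZ_candidates sigma j).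
Proof.
have enumP (A : {set 'I_n}) (P : pred 'I_n) :
    pairwise (fun x y => x < y) [seq x <- enum A | P x].
  have : pairwise (fun x y : 'I_n => x < y) (enum 'I_n).
    rewrite -(pairwise_map val ltn) val_enum_ord -sorted_pairwise ?iota_ltn_sorted //.
    exact: ltn_trans.
  rewrite [enum A]/enum_mem -enumT -filter_predI.
  exact: (subseq_pairwise (filter_subseq _ _)).
rewrite /SZ_candidates; case: ifP => _ //.
rewrite -sorted_pairwise; last by move=> x y z h1 h2; apply: ltn_trans h2 h1.
by rewrite rev_sorted sorted_pairwise ?enumP // => x y z; apply: ltn_trans.
Qed.

(** Candidates for j not chosen before j's turn are images of letters visited after
    j, and those preceding tau j among them are exactly the images of the i crossing
    j; [stat312_at j sigma] is by definition the number of candidates skipped. *)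
Lemma stat312_crossing j : stat312_at j sigma = #|[set i | crossing tau i j]|.
Proof.
have [v [js e]] := SZ_order_split j; have [hs ht] := PhiSZ_nth e.
pose r x y := if j \in F then y < x else x < y.
have asym x y : r x y -> ~~ r y x by rewrite /r; case: ifP => _; lia.
have := pairwise_SZ_order sigma; rewrite e pairwise_cat allrel_consr /=.
move=> /and3P[/andP[/allP hv _] _ /andP[/allP hjs _]].
have memo i : (i \in v) || (i == j) || (i \in js).
  have : i \in order by rewrite (perm_mem (perm_SZ_order sigma)) mem_enum.
  by rewrite e mem_cat inE orbA.
(* The rank of tau j in the list of available candidates is the number of
   entries before it; count these through their preimages under tau. *)
rewrite -[LHS](count_pairwise_nth j asym _ hs); last first.
  exact: (subseq_pairwise (filter_subseq _ _)) (pairwise_SZ_candidates j).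
rewrite -ht -size_filter -filter_predI -(card_uniqP _); last first.
  by rewrite filter_uniq // uniq_SZ_candidates.
rewrite -[RHS](card_imset _ (@perm_inj _ tau)); apply: eq_card => x.
rewrite mem_filter /=; have [i ->] : exists i, x = tau i.
  by exists ((tau^-1)%g x); rewrite permKV.
rewrite mem_map ?mem_imset; try exact: perm_inj.
rewrite inE mem_SZ_candidates PhiSZ_bottom /r /crossing.
move: (memo i) (hv i) (hjs i); rewrite /SZ_before.
have [-> _ _ _|ij] := eqVneq i j; first by case: ifP; rewrite !ltnn.
rewrite orbF => mi hvi hji.
have := descent_topE i; have := descent_topE j.
have : uniq order by rewrite (perm_uniq (perm_SZ_order sigma)) enum_uniq.
have {ij} : i != j :> nat by [].
case: (boolP (i \in v)) hvi mi => [_ /(_ isT) + _ | _ _ /= hi].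
  by case: (i \in F); case: (j \in F) => /=; lia.
by move: (hji hi); case: (i \in F); case: (j \in F) => /=; lia.
Qed.

(** The left side counts the descents straddling l.  These are the descents with
    top above l, except those with bottom at least l; tau turns tops into the
    sources and bottoms into the targets of its descending arcs, whence the same
    difference counts the arcs straddling l. *)
Lemma stat312_231 l :
  stat312_at l sigma + stat231_at l sigma = #|[set i | tau i < l < i]|.
Proof.
pose S := [set p in descents sigma | (sigma p.2 < l) && (l < sigma p.1)].
have -> : stat312_at l sigma + stat231_at l sigma = #|S|.
  rewrite -(cardsID [set p : 'I_n * 'I_n | p.2 < (sigma^-1)%g l] S).
  congr (_ + _); apply: eq_card => p.
    by rewrite !inE /=; lia.
  have posN q : sigma q != l -> (sigma^-1)%g l != q :> nat.
    by apply: contra => /eqP/val_inj <-; rewrite permKV.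
  have := posN p.1; have := posN p.2; rewrite -!val_eqE !inE /succ_pos /=; lia.
pose T := [set p in descents sigma | l <= sigma p.2].
have ST : #|S| + #|T| = #|[set p in descents sigma | l < sigma p.1]|.
  rewrite -[RHS](cardsID [set p : 'I_n * 'I_n | sigma p.2 < l]).
  congr (_ + _); apply: eq_card => p;
  by rewrite !inE /=; lia.
apply/eqP; rewrite -(eqn_add2r #|T|) ST.
rewrite -(card_tops sigma (fun x => l < x)) -(card_bottoms sigma (fun x => l <= x)).
rewrite -(cardsID [set i | l <= tau i] [set x in F | l < x]) addnC.
have -> : [set x in F | l < x] :\: [set i | l <= tau i] = [set i | tau i < l < i].
  by apply/setP=> i; rewrite !inE descent_topE; lia.
rewrite eqn_add2l -[X in X == _](card_imset _ (@perm_inj _ tau)); apply/eqP/eq_card => x.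
have [i ->] : exists i, x = tau i by exists ((tau^-1)%g x); rewrite permKV.
rewrite mem_imset; last exact: perm_inj.
by rewrite !inE PhiSZ_bottom descent_topE; lia.
Qed.
End Phi.

(** * Injectivity of PhiSZ *)

Section Reconstruction.
Variables (n : nat) (sigma : 'S_n).
Implicit Types (l x y z : 'I_n) (p : 'I_n * 'I_n).

Local Notation F := (descent_tops sigma).
Local Notation F' := (descent_bottoms sigma).
Local Notation pos x := ((sigma^-1)%g x).

(** When only the letters at least k have been placed, the letters with this property
    are those ending a block that will be followed by a letter not yet placed. *)
Definition falls_below (k : nat) x : bool :=
  [exists y : 'I_n, (pos y == (pos x).+1 :> nat) && (y < k)].

Definition falls_before l x : {set 'I_n} :=
  [set y : 'I_n | [&& l < y, falls_below l.+1 y & pos y < pos x]].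

Lemma falls_below_top l : falls_below l l = (l \in F).
Proof.
apply/existsP/imsetP=> [[y /andP[/eqP e h]]|[p]].
  by exists (pos l, pos y); rewrite ?inE /succ_pos /= ?permKV //= e eqxx h.
rewrite inE => /andP[/eqP e h] ->; exists (sigma p.2).
by rewrite !permK e eqxx h.
Qed.

(** A letter above l followed by a letter at most l is followed either by a letter
    below l, giving an occurrence of 31-2 when it lies left of l, or by l itself. *)
Lemma card_falls_before l :
  #|falls_before l l| = stat312_at l sigma + (l \in F').
Proof.
pose Q := [set p : 'I_n * 'I_n | [&& succ_pos p, p.2 <= pos l, sigma p.2 <= l & l < sigma p.1]].
have posN q : sigma q != l -> pos l != q :> nat.
  by apply: contra => /eqP/val_inj <-; rewrite permKV.
have -> : #|falls_before l l| = #|Q|.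
  rewrite -(@card_in_imset _ _ (fun p => sigma p.1) Q); last first.
    move=> [a b] [c d]; rewrite !inE /succ_pos /= => /andP[/eqP h1 _] /andP[/eqP h2 _].
    by move=> /perm_inj h; subst c; congr pair; apply: val_inj; rewrite /= h1 h2.
  apply: eq_card => y; rewrite inE; apply/and3P/imsetP.
    case=> ly /existsP[z /andP[/eqP e zl]] h; exists (pos y, pos z); rewrite ?permKV //.
    by rewrite inE /succ_pos /= !permKV e eqxx ly h -ltnS zl.
  case=> p; rewrite inE => /and4P[/eqP e h1 h2 h3] ->; rewrite permK; split=> //.
    by apply/existsP; exists (sigma p.2); rewrite !permK e eqxx ltnS.
  by rewrite -e.
rewrite -(cardsID [set p : 'I_n * 'I_n | sigma p.2 < l]); congr (_ + _).
  apply: eq_card => p; rewrite !inE.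
  by have := posN p.2; rewrite -val_eqE /=; lia.
rewrite -[RHS]/(nat_of_bool _); transitivity #|[set x in F' | x == l]|.
  rewrite (card_bottoms sigma (pred1 l)); apply: eq_card => p; rewrite !inE /=.
  rewrite -leqNgt; have := permK sigma p.2; rewrite -val_eqE /=.
  case: (eqVneq (sigma p.2) l) => [->|]; last by rewrite -val_eqE /=; lia.
  by move=> ->; lia.
case: (boolP (l \in F')) => h.
  rewrite /= -[RHS](cards1 l); apply: eq_card => x; rewrite !inE andbC.
  by case: eqP => // ->.
apply/eqP; rewrite cards_eq0; apply/eqP/setP=> x; rewrite !inE andbC.
by case: eqP => // ->; apply: negbTE.
Qed.

(** Between a letter above l and l, the word must step down to level l at least
    once: take the last position before l that holds a letter above l. *)
Lemma exists_fall l x : l < x -> pos x < pos l ->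
  exists2 y, y \in falls_before l l & pos x <= pos y.
Proof.
move=> lx xl.
case: (@arg_maxnP _ (pos x) (fun q : 'I_n => (pos x <= q < pos l) && (l < sigma q)) val).
  by rewrite leqnn xl permKV.
move=> q /andP[/andP[xq ql] lq] qmax; exists (sigma q); last by rewrite permK.
rewrite !inE lq permK ql andbT; apply/existsP.
have hq : q.+1 < n by apply: leq_ltn_trans ql _.
exists (sigma (Ordinal hq)); rewrite !permK eqxx /= ltnS leqNgt; apply/negP=> h.
have := qmax (Ordinal hq); rewrite h /= andbT ltnn.
have : pos l != q.+1 :> nat.
  apply/eqP=> e; have e' : pos l = Ordinal hq by apply: val_inj.
  by rewrite -e' permKV ltnn in h.
move=> *; lia.
Qed.

(** The insertion rule: l goes right after the block ended by the fall whose rank is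
    [stat312_at l sigma + (l \in F')], counted from the left.  A larger
    letter x left of l belongs to that block or an earlier one, so a fall at or after
    x is still to come before l; right of l, all those falls precede x. *)
Lemma pos_lt_letter l x : l < x ->
  (pos x < pos l) = (#|falls_before l x| < stat312_at l sigma + (l \in F')).
Proof.
move=> lx; rewrite -card_falls_before.
case: (ltnP (pos x) (pos l)) => h; apply/esym.
  have [y yin xy] := exists_fall lx h.
  apply: proper_card; apply/properP; split; last first.
    by exists y => //; rewrite inE (ltnNge (pos y)) xy !andbF.
  by apply/subsetP=> z; rewrite !inE => /and3P[-> -> /ltn_trans->].
apply/negbTE; rewrite -leqNgt; apply/subset_leq_card/subsetP=> z.
by rewrite !inE => /and3P[-> -> /leq_trans->].
Qed.

(** Inserting l changes the status of at most one letter above l, the one that l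
    immediately follows; there is one when l is a descent bottom, and it is then the
    last fall left of l. *)
Lemma falls_below_step l x : l < x ->
  falls_below l x = falls_below l.+1 x &&
    ~~ [&& l \in F', pos x < pos l &
           [forall y, (y \in falls_before l l) ==> (pos y <= pos x)]].
Proof.
move=> lx; apply/existsP/andP=> [[y /andP[/eqP e yl]]|[/existsP[y /andP[/eqP e yl]]]].
  split; first by apply/existsP; exists y; rewrite e eqxx ltnW.
  apply/negP=> /and3P[/imsetP[p]]; rewrite inE => /andP[/eqP ep hp] el xl /forallP allx.
  have:= allx (sigma p.1); rewrite inE permK; apply/negP; rewrite negb_imply.
  rewrite el permK in xl *; rewrite hp ep ltnS leqnn -ltnNge !andbT.
  have neq : p.1 != pos x :> nat.
    apply/eqP=> e1; have e2 : pos y = p.2 by apply: val_inj; rewrite /= e ep e1.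
    by move: yl; rewrite el -e2 permKV ltnn.
  apply/andP; split; last by rewrite ltn_neqAle eq_sym neq /=; move: xl; rewrite ep ltnS.
  by apply/existsP; exists (sigma p.2); rewrite !permK ep eqxx ltnS /=.
move=> hN; exists y; rewrite e eqxx /=; move: yl; rewrite ltnS leq_eqVlt.
case/predU1P=> // /val_inj yE; case/negP: hN; subst y; apply/and3P; split; last 2 first.
- by rewrite e.
- by apply/forallP=> z; rewrite inE e ltnS; apply/implyP=> /and3P[].
by apply/imsetP; exists (pos x, pos l); rewrite ?inE /succ_pos /= ?permKV // e eqxx.
Qed.

End Reconstruction.

Lemma card_ord_lt n k : k <= n -> #|[set i : 'I_n | i < k]| = k.
Proof.
by move=> h; rewrite -sum1dep_card (big_ord_narrow h) sum1_card card_ord.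
Qed.

Lemma eq_from_pos n (s t : 'S_n) :
    (forall x y, ((s^-1)%g x < (s^-1)%g y) = ((t^-1)%g x < (t^-1)%g y)) ->
  s = t.
Proof.
move=> h.
have rank (u : 'S_n) x : (u^-1)%g x = #|[set y | (u^-1)%g y < (u^-1)%g x]| :> nat.
  rewrite -(card_imset _ (@perm_inj _ (u^-1)%g)).
  have -> : [set (u^-1)%g y | y in [set y | (u^-1)%g y < (u^-1)%g x]]
     = [set i : 'I_n | i < (u^-1)%g x].
    apply/setP=> i; rewrite -{1}[i](permK u) mem_imset; last exact: perm_inj.
    by rewrite !inE permK.
  by rewrite card_ord_lt // ltnW.
apply: invg_inj; apply/permP=> x; apply: val_inj; rewrite /= (rank s) (rank t).
by apply: eq_card => y; rewrite !inE h.
Qed.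

(** Downward induction on k: the two words agree on the relative order of the
    letters at least k and on which of these are followed by a letter below k. *)
Lemma reconstruction n (s t : 'S_n) :
    descent_tops s = descent_tops t -> descent_bottoms s = descent_bottoms t ->
    (forall l, stat312_at l s = stat312_at l t) ->
  s = t.
Proof.
move=> eF eF' e312; apply: eq_from_pos.
pose agree k :=
  (forall x y : 'I_n, k <= x -> k <= y ->
     ((s^-1)%g x < (s^-1)%g y) = ((t^-1)%g x < (t^-1)%g y)) /\
  (forall x : 'I_n, k <= x -> falls_below s k x = falls_below t k x).
suff main d : forall k, n <= k + d -> agree k.
  by have [ord _] := main n 0 (leqnn n); move=> x y; apply: ord.
elim: d => [|d IH] k hk.
  by split=> [x y|x]; have := ltn_ord x; lia.
have [hkn|] := ltnP k n; last by move=> h; split=> [x y|x]; have := ltn_ord x; lia.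
have [IHo IHf] := IH k.+1 ltac:(lia).
pose l := Ordinal hkn.
have eq_before (x : 'I_n) : l < x -> falls_before s l x = falls_before t l x.
  move=> lx; apply/setP=> y; rewrite !inE.
  by case: ltnP => //= ly; rewrite IHf // IHo.
have eq_l (x : 'I_n) : l < x -> ((s^-1)%g x < (s^-1)%g l) = ((t^-1)%g x < (t^-1)%g l).
  by move=> lx; rewrite !pos_lt_letter // eq_before // e312 eF'.
have ltN (u : 'S_n) (x : 'I_n) :
    l < x -> ((u^-1)%g l < (u^-1)%g x) = ~~ ((u^-1)%g x < (u^-1)%g l).
  move=> lx; rewrite -leqNgt ltn_neqAle.
  case: eqP => // /val_inj /perm_inj e; by rewrite e ltnn in lx.
split=> [x y|x]; rewrite leq_eqVlt.
  case/predU1P=> [kx|kx]; rewrite leq_eqVlt; case/predU1P=> [ky|ky].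
  - have -> : x = l by apply: val_inj.
    have -> : y = l by apply: val_inj.
    by rewrite !ltnn.
  - have -> : x = l by apply: val_inj.
    by rewrite !ltN // eq_l.
  - have -> : y = l by apply: val_inj.
    exact: eq_l.
  - exact: IHo.
case/predU1P=> [kx|kx].
  have -> : x = l by apply: val_inj.
  by rewrite !(falls_below_top _ l) eF.
rewrite (falls_below_step s (l := l) kx) (falls_below_step t (l := l) kx).
rewrite IHf // eF' eq_l //; congr (_ && ~~ [&& _, _ & _]).
apply: eq_forallb => y; rewrite !inE; case: ltnP => //= ly.
by rewrite IHf // eq_l // (leqNgt ((s^-1)%g y)) (leqNgt ((t^-1)%g y)) IHo.
Qed.

Lemma PhiSZ_inj n : injective (@PhiSZ n).
Proof.
move=> s t e.
have eF : descent_tops s = descent_tops t by apply/setP=> j; rewrite !descent_topE e.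
apply: reconstruction => // [|l]; last by rewrite !stat312_crossing e.
apply/setP=> x; have [i ->] : exists i, x = PhiSZ s i.
  by exists ((PhiSZ s)^-1%g x); rewrite permKV.
by rewrite PhiSZ_bottom eF e PhiSZ_bottom.
Qed.

(** * Steps up and down through a level *)

(** Turns a count of pairs of adjacent positions into a sum that can be unrolled from
    the end of the word. *)
Lemma card_succ_pos m (P : rel 'I_m.+1) :
  #|[set p | succ_pos p & P p.1 p.2]|
    = \sum_(j < m) (P (inord j) (inord j.+1) : nat).
Proof.
pose h (j : 'I_m) : 'I_m.+1 * 'I_m.+1 := (inord j, inord j.+1).
have h1 (j : 'I_m) : (inord j : 'I_m.+1) = j :> nat by rewrite inordK // ltnW // ltnS.
have h2 (j : 'I_m) : (inord j.+1 : 'I_m.+1) = j.+1 :> nat by rewrite inordK // ltnS.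
have h_inj : injective h by move=> i j [e _]; apply: val_inj; rewrite /= -h1 e h1.
transitivity #|[set h j | j in [set j : 'I_m | P (inord j) (inord j.+1)]]|; last first.
  by rewrite card_imset // -sum1dep_card big_mkcond; apply: eq_bigr => j _; case: (P _ _).
apply: eq_card => -[a b]; apply/idP/imsetP => [|[j]]; rewrite !inE /succ_pos /=.
  case/andP=> /eqP e Pab; have ha : a < m by rewrite -ltnS -e.
  have ea : inord a = a :> 'I_m.+1 by rewrite inord_val.
  have eb : inord a.+1 = b :> 'I_m.+1 by rewrite -e inord_val.
  by exists (Ordinal ha); rewrite ?inE /h /= ea eb.
by move=> Pj [-> ->]; rewrite h1 h2 eqxx.
Qed.

(** Telescoping: a step up minus a step down is w j.+1 - w j. *)
Lemma up_down_balance (w : pred nat) p m : p < m ->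
  \sum_(j < m) [&& p < j, ~~ w j & w j.+1] + w p.+1
    = \sum_(j < m) [&& p < j, ~~ w j.+1 & w j] + w m.
Proof.
elim: m => // m IH; rewrite ltnS leq_eqVlt !big_ord_recr /=.
case/predU1P=> [<-|pm].
  by rewrite ltnn !big1 // => j _; rewrite ltnNge ltnW.
move: (IH pm); rewrite pm /=.
by case: (w m); case: (w m.+1) => /=; lia.
Qed.

(** Telescoping over the positions right of l, the difference of the two statistics
    is the level of the last letter minus the level of the letter following l, where
    the level is 1 above l and 0 below.  A letter that is not a descent top is either
    followed by a larger letter or last; adding the second case to both sides
    gives this form, which also covers l = sigma ord_max. *)
Lemma stat213_231 m (sigma : 'S_m.+1) (l : 'I_m.+1) :
  stat213_at l sigma + (l \notin descent_tops sigma)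
    = stat231_at l sigma + (l <= sigma ord_max).
Proof.
set p := (sigma^-1)%g l.
have sp : sigma p = l by rewrite permKV.
have neq k : k != p -> sigma k != l :> nat.
  by apply: contraNneq => e; apply/eqP/(@perm_inj _ sigma)/val_inj; rewrite sp.
pose w k := l < sigma (inord k).
(* Right of l no letter equals l, so the letters below l are those not above it. *)
have wN (k : nat) : p < k <= m -> (sigma (inord k) < l) = ~~ w k.
  case/andP=> pk km; rewrite /w -leqNgt ltn_neqAle neq // -val_eqE /= inordK ?ltnS //.
  by rewrite gtn_eqF.
have e213 : stat213_at l sigma = \sum_(j < m) [&& p < j, ~~ w j & w j.+1].
  apply: etrans (card_succ_pos
    (fun i j => [&& p < i, sigma i < l & l < sigma j])) _; apply: eq_bigr => j _.
  rewrite inordK; last by rewrite ltnW // ltnS.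
  by case: (ltnP p j) => //= pj; rewrite wN // pj ltnW.
have e231 : stat231_at l sigma = \sum_(j < m) [&& p < j, ~~ w j.+1 & w j].
  apply: etrans (card_succ_pos
    (fun i j => [&& p < i, sigma j < l & l < sigma i])) _; apply: eq_bigr => j _.
  rewrite inordK; last by rewrite ltnW // ltnS.
  by case: (ltnP p j) => //= pj; rewrite wN // ltnW //=.
have [pm|mp] := ltnP p m; last first.
  have pE : p = ord_max by apply/val_inj/eqP; rewrite eqn_leq mp -ltnS ltn_ord.
  rewrite -pE sp leqnn e213 e231 !big1; last 2 first.
  - by move=> j _; rewrite ltnNge (leq_trans _ mp) // ltnW.
  - by move=> j _; rewrite ltnNge (leq_trans _ mp) // ltnW.
  suff -> : l \notin descent_tops sigma by [].
  apply/imsetP=> -[[a b]]; rewrite inE /succ_pos -sp /= => /andP[/eqP e _] /perm_inj ap.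
  by have := ltn_ord b; rewrite e -ap pE /= ltnn.
have -> : (l \notin descent_tops sigma) = w p.+1.
  rewrite -[RHS]negbK -wN ?leqnn //; congr (~~ _).
  have eP : (inord p.+1 : 'I_m.+1) = p.+1 :> nat by rewrite inordK.
  apply/imsetP/idP=> [[[a b]]|h].
    rewrite inE /succ_pos -{1}sp /= => /andP[/eqP e h] /perm_inj ap.
    by rewrite ap in eP *; rewrite -sp ap -e inord_val.
  by exists (p, inord p.+1); rewrite ?inE /succ_pos /= ?sp ?eP ?eqxx.
have -> : (l <= sigma ord_max) = w m.
  rewrite /w (_ : inord m = ord_max); last by apply: val_inj; rewrite /= inordK.
  by rewrite [RHS]ltn_neqAle eq_sym neq // -val_eqE /= gtn_eqF.
by rewrite e213 e231 up_down_balance.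
Qed.

(** A bijection sends as many points from below l to l or above as it sends the other
    way; the case i = l is split off on the side of the descending arcs. *)
Lemma arcs_across_balance n (t : 'S_n) (l : 'I_n) :
  #|[set i | t i < l < i]| + (t l < l) = #|[set i : 'I_n | i < l <= t i]|.
Proof.
have e : #|[set i | t i < l]| = #|[set i : 'I_n | i < l]|.
  rewrite -(card_imset [set i | t i < l] (@perm_inj _ t)); apply: eq_card => x.
  by rewrite -[x](permKV t) mem_imset ?inE //; apply: perm_inj.
have e1 : #|[set i | t i < l]|
    = #|[set i | t i < l < i]| + (t l < l) + #|[set i : 'I_n | (i < l) && (t i < l)]|.
  rewrite -[LHS](cardsID [set i : 'I_n | l < i]) -addnA; congr (_ + _).
    by apply: eq_card => i; rewrite !inE.
  rewrite (cardsD1 l) !inE ltnn /=; congr (_ + _); apply: eq_card => i.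
  by rewrite !inE -val_eqE /=; lia.
have e2 : #|[set i : 'I_n | i < l]|
    = #|[set i : 'I_n | i < l <= t i]| + #|[set i : 'I_n | (i < l) && (t i < l)]|.
  rewrite -[LHS](cardsID [set i | l <= t i]); congr (_ + _); apply: eq_card => i;
  by rewrite !inE; lia.
by apply/eqP; rewrite -(eqn_add2r #|[set i : 'I_n | (i < l) && (t i < l)]|) -e1 -e2 e.
Qed.

(** Let l be the last letter and q the preimage of the maximum.  A letter larger than
    l that is not a descent top is followed by a larger letter, hence has a straddling
    descent to its right; this fails for q, because every arc going up across q
    crosses the arc of q, which attains the maximum, so that all the straddling
    descents are counted by [stat312_at]; hence q <= l.  Since nothing lies
    right of l, every arc going up across l has to cross the arc of l, that is to end
    below tau l; as the arc of q does not, q < l is impossible. *)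
Lemma PhiSZ_last m (sigma : 'S_m.+1) : PhiSZ sigma (sigma ord_max) = ord_max.
Proof.
set t := PhiSZ sigma; set l := sigma ord_max.
pose q := (t^-1)%g ord_max; have tq : t q = ord_max by rewrite permKV.
have le_max (x : 'I_m.+1) : x <= m by rewrite -ltnS.
have tN i : i != q -> t i < m.
  move=> h; rewrite ltn_neqAle le_max andbT; apply: contra h => /eqP e.
  by apply/eqP/(@perm_inj _ t)/val_inj; rewrite tq.
have lq : q <= l.
  have Fq : q \notin descent_tops sigma by rewrite descent_topE -/t tq -leqNgt.
  have := stat213_231 sigma q; rewrite Fq -/l leqNgt; case: ltnP => //= lq.
  have := stat312_231 sigma q; rewrite stat312_crossing -/t.
  have := arcs_across_balance t q; rewrite tq ltnNge le_max /= addn0 => ->.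
  have: #|[set i : 'I_m.+1 | i < q <= t i]| <= #|[set i | crossing t i q]|.
    apply/subset_leq_card/subsetP=> i; rewrite !inE /crossing => /andP[iq ->].
    by rewrite iq tq tN ?orbT // -val_eqE /= ltn_eqF.
  by move: #|_| #|_| (stat231_at _ _) => a b c h1 h2 h3; exfalso; lia.
have e231 : stat231_at l sigma = 0.
  apply: eq_card0 => p; rewrite inE permK /=; apply/negbTE.
  by rewrite !negb_and -leqNgt le_max orbT.
have Fl : l \notin descent_tops sigma.
  have := stat213_231 sigma l; rewrite e231 leqnn.
  suff -> : stat213_at l sigma = 0 by case: (l \notin _).
  apply: eq_card0 => p; rewrite inE permK /=; apply/negbTE.
  by rewrite !negb_and -leqNgt le_max orbT.
have := stat312_231 sigma l; rewrite e231 addn0 stat312_crossing -/t.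
have := arcs_across_balance t l; move: Fl; rewrite descent_topE -/t => Fl.
rewrite (negbTE Fl) addn0 => -> /eqP.
have S : [set i | crossing t i l] \subset [set i : 'I_m.+1 | i < l <= t i].
  by apply/subsetP=> i; rewrite !inE /crossing; lia.
(* Two sets of the same size, one inside the other: all arcs going up across l
   cross the arc of l. *)
move=> e; have /eqP/setP/(_ q) : [set i | crossing t i l] == [set i : 'I_m.+1 | i < l <= t i].
  by rewrite eqEcard S (eqP e) leqnn.
rewrite !inE /crossing tq /= [l <= m]le_max andbT.
have [ql|lq'] := ltnP q l; last first.
  by suff -> : l = q by []; apply/val_inj/eqP; rewrite eqn_leq lq' lq.
by have := le_max (t l); lia.
Qed.

(** * The permutation thetahat *)

Section Hat.
Variables (m : nat) (t : 'S_m.+1).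
Implicit Types i j l : 'I_m.+1.
Local Notation t' := (thetahat t).

(** On values, m.-1 - t i is the reversal of the range below the maximum m. *)
Lemma thetahat_rev i :
  t' (rev_ord i) = (if t i == ord_max then m else m.-1 - t i) :> nat.
Proof.
rewrite permE rev_ordK -val_eqE /=.
by have := ltn_ord (t i); do 2!case: ifP; lia.
Qed.

(** Reversal exchanges the two kinds of crossings pair by pair, unless t j is the
    maximum.  In that case the crossings at j are all the arcs going up across j,
    those at [rev_ord j] come from all the arcs going down across j, and these are
    equally many by [arcs_across_balance]. *)
Lemma crossing_thetahat j :
  #|[set i | crossing t' i (rev_ord j)]| = #|[set i | crossing t i j]|.
Proof.
rewrite -(card_imset [set i | crossing t i j] (@rev_ord_inj _)).
have le_max i : t i <= m by rewrite -ltnS.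
have neq i : i != j :> nat -> t i != t j :> nat.
  by apply: contraNneq => /val_inj/perm_inj->.
case: (eqVneq (t j) ord_max) => [tj|].
  transitivity #|[set i | t i < j < i]|.
    rewrite -[RHS](card_imset _ (@rev_ord_inj _)); apply: eq_card => i.
    rewrite -[i]rev_ordK (mem_imset _ _ (@rev_ord_inj _)) !inE.
    move: {i}(rev_ord i) => i; rewrite /crossing !thetahat_rev tj eqxx /= -val_eqE /=.
    have := ltn_ord i; have := ltn_ord j; have := neq i; have := le_max i; rewrite tj /=.
    by case: (eqVneq (t i : nat) m) => ?; lia.
  have := arcs_across_balance t j; rewrite tj ltnNge -ltnS ltn_ord addn0 => ->.
  rewrite (card_imset _ (@rev_ord_inj _)); apply: eq_card => i; rewrite !inE /crossing tj /=.
  have := ltn_ord i; have := ltn_ord j; have := neq i; have := le_max i; rewrite tj /=.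
  by lia.
move=> tj; apply: eq_card => i.
rewrite -[i]rev_ordK (mem_imset _ _ (@rev_ord_inj _)) !inE.
move: {i}(rev_ord i) => i; rewrite /crossing !thetahat_rev (negbTE tj) /=.
move: tj; rewrite -!val_eqE /=.
have := ltn_ord i; have := ltn_ord j; have := le_max i; have := le_max j.
by case: (eqVneq (t i : nat) m) => ?; lia.
Qed.

(** Arcs of t going down strictly across l become arcs of [thetahat t] going up
    across [rev_ord l]; the only further such arc can be the one that ends at the
    maximum, whose value is not reversed. *)
Lemma straddle_thetahat l :
  #|[set i : 'I_m.+1 | i < rev_ord l <= t' i]|
    = #|[set i | t i < l < i]| + ((t'^-1)%g ord_max < rev_ord l).
Proof.
pose q := (t^-1)%g ord_max; have tq : t q = ord_max by rewrite permKV.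
have -> : (t'^-1)%g ord_max = rev_ord q.
  by apply: (@perm_inj _ t'); rewrite permKV; apply: val_inj; rewrite [RHS]thetahat_rev tq eqxx.
rewrite -(card_imset [set i | t i < l < i] (@rev_ord_inj _)).
rewrite (cardsD1 (rev_ord q)) addnC; congr (_ + _).
  apply: eq_card => i; rewrite -[i]rev_ordK (mem_imset _ _ (@rev_ord_inj _)) !inE.
  move: {i}(rev_ord i) => i; rewrite (inj_eq (@rev_ord_inj _)) thetahat_rev.
  case: (eqVneq i q) => [->|iq]; first by rewrite tq /=; have := ltn_ord q; lia.
  have: t i != ord_max by apply: contra iq => /eqP; rewrite -tq => /perm_inj->.
  rewrite -val_eqE /=; have := ltn_ord (t i); have := ltn_ord i; have := ltn_ord l.
  by case: eqP; lia.
rewrite inE thetahat_rev tq eqxx /=; lia.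
Qed.
End Hat.

Lemma thetahatK m : involutive (@thetahat m.+1).
Proof.
move=> t; apply/permP=> i; apply: val_inj; rewrite /= -{1}[i]rev_ordK.
rewrite thetahat_rev -val_eqE /= thetahat_rev -val_eqE /=.
have := ltn_ord (t i); case: (eqVneq (t i : nat) m) => [->|]; first by rewrite eqxx.
by move=> neq lt; case: ifP; lia.
Qed.

(** The refinement by letters.  In [stat213_231] for s', the last letter is the
    preimage of the maximum under [thetahat (PhiSZ s)], so the boundary terms are
    those of [straddle_thetahat], and the sums of the two statistics agree at l and
    [rev_ord l]; so do the two values of [stat312_at]. *)
Lemma stats_thetahat m (s s' : 'S_m.+1) (l : 'I_m.+1) :
    PhiSZ s' = thetahat (PhiSZ s) ->
  stat312_at (rev_ord l) s' = stat312_at l s /\ stat213_at (rev_ord l) s' = stat231_at l s.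
Proof.
move=> e; have e312 : stat312_at (rev_ord l) s' = stat312_at l s.
  by rewrite !stat312_crossing e crossing_thetahat.
split=> //; have := stat213_231 s' (rev_ord l); rewrite descent_topE -leqNgt.
have := stat312_231 s' (rev_ord l); have := stat312_231 s l.
have := straddle_thetahat (PhiSZ s) l; rewrite -e.
have := arcs_across_balance (PhiSZ s') (rev_ord l).
have <- : s' ord_max = ((PhiSZ s')^-1)%g ord_max by rewrite -{2}(PhiSZ_last s') permK.
by rewrite e312; lia.
Qed.

Theorem theorem1p3 (n : nat) (hn : 0 < n) :
  involutive (@phihat n) /\
  forall sigma : 'S_n,
    (stat312 sigma, stat231 sigma) =
    (stat312 (phihat sigma), stat213 (phihat sigma)).
Proof.
case: n hn => // m _.
have fK : cancel (finv (@PhiSZ m.+1)) (@PhiSZ m.+1) := f_finv (@PhiSZ_inj _).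
split=> sigma.
  by rewrite /phihat /= fK thetahatK (finv_f (@PhiSZ_inj _)).
have e : PhiSZ (phihat sigma) = thetahat (PhiSZ sigma) by apply: fK.
rewrite /stat312 /stat231 /stat213; congr pair; rewrite [RHS](reindex_inj (@rev_ord_inj _)).
  by apply: eq_bigr => l _; case: (stats_thetahat l e).
by apply: eq_bigr => l _; case: (stats_thetahat l e).
Qed.
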